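(* Let the cyclic group $\mathrm{C}_4$ act on $\mathbb{Q}^4$ by cyclically permuting the coordinates of vectors. The points $v:=[3,4,-3,-4]^T\in\mathbb{Q}^4$ and $w:=[5,0,-5,0]^T\in\mathbb{Q}^4$ have different $\mathrm{C}_4$-orbits, and all polynomial $\mathrm{C}_4$-invariants on $\mathbb{Q}^4$ of degree at most $3$ take the same value on $v$ and $w$. In particular, we have $$\beta_{\mathrm{sep}}^{\mathbb{Q}}(\mathrm{C}_4)=4.$$
   Context: For a finite group $G$, a field $\mathbb{F}$ and a finite dimensional representation $V$ of $G$ over $\mathbb{F}$, $\mathbb{F}[V]$ is the coordinate ring (polynomial algebra in the coordinate functions on $V$, with standard grading), with $G$-action $(g\cdot f)(v)=f(g^{-1}v)$, and $\mathbb{F}[V]^G$ is the subalgebra of polynomial invariants. $\beta_{\mathrm{sep}}(G,V)$ is the minimal positive integer $d$ such that for any $v,w\in V$ with $G\cdot v\neq G\cdot w$ there exists an $f\in\mathbb{F}[V]^G$ of degree at most $d$ with $f(v)\neq f(w)$. $\beta_{\mathrm{sep}}^{\mathbb{F}}(G)$ is the maximum of $\beta_{\mathrm{sep}}(G,V)$ as $V$ ranges over all finite dimensional representations of $G$ over $\mathbb{F}$. *)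

(* Defs.v *)
From HB Require Import structures.
From mathcomp Require Import all_boot all_order all_algebra.
From mathcomp Require Import all_fingroup all_solvable all_field all_character.
From mathcomp Require Import mpoly.

Set Implicit Arguments.
Unset Strict Implicit.
Unset Printing Implicit Defensive.

Import GRing.Theory.
Local Open Scope ring_scope.

(* A representation V of G is a matrix representation rG, with g acting on the
   left of column vectors by v |-> rG g *m v.  The coordinate ring F[V] is
   {mpoly F[n]}, where 'X_i is the i-th coordinate function. *)

Section SeparatingInvariants.

Variables (F : fieldType) (gT : finGroupType) (G : {group gT}).

Section OneRepresentation.

Variables (n : nat) (rG : mx_representation F G n).

Definition peval (f : {mpoly F[n]}) (v : 'cV[F]_n) : F :=
  f.@[fun i => v i 0].

Definition vorbit (v : 'cV[F]_n) : seq 'cV[F]_n := [seq rG g *m v | g in G].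

(* (g . f)(v) = f(g^-1 v): substitute for each 'X_i the i-th coordinate of
   g^-1 v, a linear form in v. *)
Definition poly_act (g : gT) (f : {mpoly F[n]}) : {mpoly F[n]} :=
  f \mPo [tuple \sum_(j < n) rG g^-1%g i j *: 'X_j | i < n].

Lemma peval_act (g : gT) (f : {mpoly F[n]}) (v : 'cV[F]_n) :
  peval (poly_act g f) v = peval f (rG g^-1%g *m v).
Proof.
rewrite /peval /poly_act comp_mpoly_meval; apply: meval_eq => i.
rewrite tnth_mktuple mxE raddf_sum /=; apply: eq_bigr => j _.
by rewrite mevalZ mevalXU.
Qed.

Definition poly_invariant (f : {mpoly F[n]}) : Prop :=
  forall g, g \in G -> poly_act g f = f.

(* msize is the total degree plus one (and msize 0 = 0). *)
Definition deg_le (d : nat) (f : {mpoly F[n]}) : Prop := (msize f <= d.+1)%N.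

Definition separating_degree (d : nat) : Prop :=
  forall v w : 'cV[F]_n, ~ (vorbit v =i vorbit w) ->
  exists f, [/\ poly_invariant f, deg_le d f & peval f v <> peval f w].

Definition is_beta_sep (d : nat) : Prop :=
  [/\ (0 < d)%N, separating_degree d &
      forall e, (0 < e)%N -> separating_degree e -> (d <= e)%N].

End OneRepresentation.

(* b is the maximum of beta_sep(G, V) over all finite dimensional V; the second
   part includes the existence of each beta_sep(G, V). *)
Definition is_beta_sep_field (b : nat) : Prop :=
  (exists n (rG : mx_representation F G n), is_beta_sep rG b) /\
  (forall n (rG : mx_representation F G n),
     exists2 d, is_beta_sep rG d & (d <= b)%N).

End SeparatingInvariants.

Arguments is_beta_sep_field F {gT} G b.

(* The group law of the finGroupType 'Z_4 is addition modulo 4. *)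
Definition C4 : {group 'Z_4} := [set: 'Z_4]%G.

(* (g . v)_i = v_(i - g), indices modulo 4. *)
Definition cyc_mx (g : 'Z_4) : 'M[rat]_4 :=
  \matrix_(i, j) (i == j + g :> 'Z_4)%:R.

Lemma cyc_mxE (g : 'Z_4) m (A : 'M[rat]_(4, m)) (i : 'Z_4) (k : 'I_m) :
  (cyc_mx g *m A) i k = A (i - g) k.
Proof.
rewrite mxE (bigD1 (i - g)) //= mxE subrK eqxx mul1r big1 ?addr0 // => j ne_j.
by rewrite mxE -subr_eq eq_sym (negPf ne_j) mul0r.
Qed.

Lemma cyc_mx_repr : mx_repr C4 cyc_mx.
Proof.
split=> [|g h _ _]; apply/matrixP=> i j; first by rewrite !mxE addr0.
rewrite cyc_mxE !mxE subr_eq -addrA.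
by congr (_ == _ + _)%:R; exact: addrC.
Qed.

Definition cyc_repr : mx_representation rat C4 4 :=
  MxRepresentation cyc_mx_repr.

Definition colvec4 (a b c d : rat) : 'cV[rat]_4 :=
  \col_(i < 4) [:: a; b; c; d]`_i.

(* Main.v *)
(** For [l] a linear form and [c] a scalar, the orbit product
    [\prod_(g in G) (c - l(g x))] is an invariant of degree at most [#|G|].  If
    [v] and [w] have different orbits, then over an infinite field some [l] is
    nonzero on every [v - g w]; taking [c = l(v)], the product vanishes at [v]
    but not at [w].  For the lower bound, an invariant takes at [v] the average
    of its values on the orbit of [v], so it suffices to compare orbit sums of
    monomials.  With [v = (a, b, -a, -b)], the monomials of odd degree have
    orbit sum zero, since shifting by 2 negates [v], and the orbit sums in
    degree 2 depend only on [a^2 + b^2 = 25]. *)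
Require Import Defs.
From Stdlib Require Classical_Prop.
From mathcomp Require Import all_boot all_order all_algebra.
From mathcomp Require Import all_fingroup all_solvable all_field all_character.
From mathcomp Require Import mpoly.
From mathcomp Require Import ring zify.

Set Implicit Arguments.
Unset Strict Implicit.
Unset Printing Implicit Defensive.

Import Order.TTheory GRing.Theory Num.Theory.
Local Open Scope ring_scope.

(** In characteristic zero the naturals below [size p] have distinct images, which are too many to
    be all roots of [p]. *)
Lemma poly_nonroot (F : numDomainType) (p : {poly F}) :
  p != 0 -> exists t, ~~ root p t.
Proof.
move=> p_neq0; pose s : seq F := [seq i%:R | i <- iota 0 (size p)].
have [all_root | /allPn[t _ ?]] := boolP (all (root p) s); last by exists t.
have uniq_s : uniq s by rewrite map_inj_uniq ?iota_uniq //; exact/mulrIn/oner_neq0.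
by have := max_poly_roots p_neq0 all_root uniq_s; rewrite size_map size_iota ltnn.
Qed.

(** Read each [u] as the coefficients of a polynomial: the row of powers of [t] evaluates it at [t].
    It suffices that [t] avoid the roots of the product of these nonzero polynomials. *)
Lemma linear_form_neq0 (F : numFieldType) (n : nat) (s : seq 'cV[F]_n) :
  0 \notin s -> exists l : 'rV_n, forall u, u \in s -> (l *m u) 0 0 != 0.
Proof.
move=> s_neq0; pose p := \prod_(u <- s) rVpoly u^T.
have [|t t_nonroot] := @poly_nonroot _ p.
  rewrite prodf_seq_neq0; apply/allP=> u u_s /=.
  apply: contraNneq s_neq0 => pu0; suff <- : u = 0 by [].
  by apply: trmx_inj; apply: (can_inj rVpolyK); rewrite pu0 trmx0 linear0.
exists (\row_i t ^+ i) => u u_s.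
suff -> : ((\row_i t ^+ i) *m u) 0 0 = (rVpoly u^T).[t].
  apply: contraNneq t_nonroot => pu_t.
  by rewrite /root horner_prod prodf_seq_eq0; apply/hasP; exists u; rewrite ?pu_t /=.
rewrite mxE horner_poly; apply: eq_bigr => i _.
by rewrite valK !mxE mulrC.
Qed.

Lemma deg_leM (F : fieldType) (n d e : nat) (p q : {mpoly F[n]}) :
  deg_le d p -> deg_le e q -> deg_le (d + e)%N (p * q).
Proof.
rewrite /deg_le => dp dq.
have [-> | p_neq0] := eqVneq p 0; first by rewrite mul0r msize0.
have [-> | q_neq0] := eqVneq q 0; first by rewrite mulr0 msize0.
by rewrite msizeM // -subn1 leq_subLR add1n -addnS -addSn leq_add.
Qed.

Lemma deg_le_prod (F : fieldType) (n : nat) (I : finType) (A : {pred I})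
    (p : I -> {mpoly F[n]}) :
  (forall i, deg_le 1 (p i)) -> deg_le #|A| (\prod_(i in A) p i).
Proof.
move=> dp; rewrite -sum1_card; apply: (big_rec2 (fun d q => deg_le d q)) => //.
  by rewrite /deg_le msize1.
by move=> i d q _; exact: deg_leM.
Qed.

Section OrbitProduct.

Variables (F : fieldType) (gT : finGroupType) (G : {group gT}) (n : nat).
Variable rG : mx_representation F G n.

Definition lin_mpoly (l : 'rV[F]_n) : {mpoly F[n]} := \sum_i l 0 i *: 'X_i.

Definition orbit_prod (c : F) (l : 'rV[F]_n) : {mpoly F[n]} :=
  \prod_(g in G) (c%:MP - lin_mpoly (l *m rG g)).

Lemma peval_lin_mpoly l v : peval (lin_mpoly l) v = (l *m v) 0 0.
Proof.
rewrite /peval raddf_sum mxE; apply: eq_bigr => i _ /=.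
by rewrite mevalZ mevalXU.
Qed.

Lemma poly_act_lin_mpoly g l :
  poly_act rG g (lin_mpoly l) = lin_mpoly (l *m rG g^-1%g).
Proof.
rewrite /poly_act /lin_mpoly raddf_sum /=.
under eq_bigr => i _.
  rewrite comp_mpolyZ comp_mpolyXU -tnth_nth tnth_mktuple scaler_sumr.
  over.
rewrite exchange_big; apply: eq_bigr => j _ /=.
by rewrite mxE scaler_suml; apply: eq_bigr => i _; rewrite scalerA.
Qed.

Lemma deg_le_lin_mpoly l : deg_le 1 (lin_mpoly l).
Proof.
apply: (leq_trans (msize_sum _ _ _)); apply/bigmax_leqP => i _.
by apply: leq_trans (msizeZ_le _ _) _; rewrite msizeX mdeg1.
Qed.

Lemma peval_orbit_prod c l v :
  peval (orbit_prod c l) v = \prod_(g in G) (c - (l *m (rG g *m v)) 0 0).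
Proof.
rewrite /peval rmorph_prod; apply: eq_bigr => g _ /=.
by rewrite mevalB mevalC -/(peval _ v) peval_lin_mpoly mulmxA.
Qed.

(** Acting by [h] turns the factor of [g] into that of [g * h^-1], so it only permutes the
    factors. *)
Lemma orbit_prod_invariant c l : poly_invariant rG (orbit_prod c l).
Proof.
move=> h Gh; rewrite /poly_act /orbit_prod rmorph_prod /=.
rewrite [RHS](reindex_inj (mulIg h^-1%g)) /=.
apply: eq_big => [g | g Gg]; first by rewrite groupMr ?groupV.
rewrite comp_mpolyB comp_mpolyC -/(poly_act rG h _) poly_act_lin_mpoly.
by rewrite repr_mxM ?groupV // mulmxA.
Qed.

Lemma deg_le_orbit_prod c l : deg_le #|G| (orbit_prod c l).
Proof.
apply: deg_le_prod => g; apply: leq_trans (msizeD_le _ _) _.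
rewrite msizeN geq_max; apply/andP; split; last exact: deg_le_lin_mpoly.
by rewrite msizeC; case: (_ == _).
Qed.

End OrbitProduct.

Section SeparatingDegree.

Variables (gT : finGroupType) (G : {group gT}) (n : nat).

Lemma vorbit_eq (F : fieldType) (rG : mx_representation F G n) v w g :
  g \in G -> v = rG g *m w -> vorbit rG v =i vorbit rG w.
Proof.
move=> Gg -> u; apply/imageP/imageP => -[h Gh ->].
  by exists (h * g)%g; rewrite ?groupM // repr_mxM // mulmxA.
exists (h * g^-1)%g; first by rewrite groupM ?groupV.
by rewrite mulmxA -repr_mxM ?groupM ?groupV // mulgKV.
Qed.

Lemma separating_degree_card (F : numFieldType)
    (rG : mx_representation F G n) : separating_degree rG #|G|.
Proof.
move=> v w neq_vw.
have [|l l_neq0] := @linear_form_neq0 F n [seq v - rG g *m w | g in G].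
  apply/imageP => -[g Gg /esym/eqP]; rewrite subr_eq0 => /eqP v_gw.
  by apply: neq_vw; exact: vorbit_eq v_gw.
exists (orbit_prod rG ((l *m v) 0 0) l); split.
- exact: orbit_prod_invariant.
- exact: deg_le_orbit_prod.
(* The factor at [g = 1] vanishes at [v]; at [w] the factor of [g] is [l] applied to
   [v - rG g *m w]. *)
rewrite !peval_orbit_prod (bigD1 1%g) //= repr_mx1 mul1mx subrr mul0r.
apply/eqP; rewrite eq_sym; apply/prodf_neq0 => g Gg.
have := l_neq0 _ (image_f (fun g => v - rG g *m w) Gg).
by rewrite mulmxBr !mxE.
Qed.

(** A least separating degree is found by strong induction; excluded middle is invoked because
    [separating_degree] is a [Prop] with no decision procedure at hand. *)
Lemma is_beta_sep_exists (F : fieldType) (rG : mx_representation F G n) b :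
  (0 < b)%N -> separating_degree rG b ->
  exists2 d, is_beta_sep rG d & (d <= b)%N.
Proof.
elim/ltn_ind: b => b IHb b_gt0 sep_b.
have [[e [e_gt0 lt_eb sep_e]] | no_less] := Classical_Prop.classic
    (exists e, [/\ (0 < e)%N, (e < b)%N & separating_degree rG e]).
  have [d beta_d le_de] := IHb e lt_eb e_gt0 sep_e.
  by exists d => //; rewrite ltnW // (leq_ltn_trans le_de).
exists b => //; split=> // e e_gt0 sep_e; rewrite leqNgt.
by apply/negP => lt_eb; apply: no_less; exists e.
Qed.

End SeparatingDegree.

(** The average over the group, multiplied out by [#|G|] so that it holds in every
    characteristic. *)
Lemma invariant_orbit_sum (F : fieldType) (gT : finGroupType)
    (G : {group gT}) (n : nat) (rG : mx_representation F G n) f v :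
  poly_invariant rG f -> peval f v *+ #|G| = \sum_(g in G) peval f (rG g *m v).
Proof.
move=> inv_f; rewrite -sumr_const; apply: eq_bigr => g Gg.
by rewrite -{1}(inv_f g^-1%g) ?groupV // peval_act invgK.
Qed.

Lemma C4_orbit_sum_monomial (m : 'X_{1.. 4}) : (mdeg m <= 3)%N ->
  \sum_(g in C4) \prod_i (cyc_repr g *m colvec4 3 4 (-3) (-4)) i 0 ^+ m i =
  \sum_(g in C4) \prod_i (cyc_repr g *m colvec4 5 0 (-5) 0) i 0 ^+ m i.
Proof.
have cycE a b c d (g i : 'Z_4) :
    (cyc_repr g *m colvec4 a b c d) i 0 = [:: a; b; c; d]`_(i - g)%R.
  by rewrite [LHS](cyc_mxE g (colvec4 a b c d) i 0) mxE.
have orbit_sumE a b c d :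
    \sum_(g in C4) \prod_i (cyc_repr g *m colvec4 a b c d) i 0 ^+ m i =
    (* The index is [i - g] in ['Z_4] written with natural numbers, so that it computes once the
       sums are expanded. *)
    \sum_(g : 'I_4) \prod_(i < 4) [:: a; b; c; d]`_((i + (4 - g)) %% 4) ^+ m i.
  apply: eq_big => [g | g _]; first by rewrite inE.
  apply: eq_bigr => i _; rewrite cycE; congr (_`_ _ ^+ _).
  by rewrite /= modnDmr.
rewrite !orbit_sumE mdegE !big_ord_recl !big_ord0.
(* Each exponent is 0, 1, 2, 3 or at least 4. [lia] discards the cases of total degree above 3, and
   [ring] checks the numerical identity in the others. *)
move: (m _) (m _) (m _) (m _) => /=
  [|[|[|[|e0]]]] [|[|[|[|e1]]]] [|[|[|[|e2]]]] [|[|[|[|e3]]]] le3;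
  first [exfalso; lia | ring].
Qed.

Lemma C4_invariant_agree (f : {mpoly rat[4]}) :
  poly_invariant cyc_repr f -> deg_le 3 f ->
  peval f (colvec4 3 4 (-3) (-4)) = peval f (colvec4 5 0 (-5) 0).
Proof.
move=> inv_f deg_f; apply: (@pmulrnI _ #|C4|); first exact: cardG_gt0.
rewrite !(invariant_orbit_sum _ inv_f) /peval.
under eq_bigr => g _ do rewrite mevalE.
under [RHS]eq_bigr => g _ do rewrite mevalE.
rewrite exchange_big [RHS]exchange_big /=.
(* Membership of [m] in the support of [f] is kept, since it bounds the degree of [m]. *)
rewrite !big_seq; apply: eq_bigr => m m_f.
rewrite -!mulr_sumr C4_orbit_sum_monomial // -ltnS.
exact: leq_trans (msize_mdeg_lt m_f) deg_f.
Qed.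

Theorem proposition4p4 :
  let v := colvec4 3 4 (-3) (-4) in
  let w := colvec4 5 0 (-5) 0 in
  [/\ ~ (vorbit cyc_repr v =i vorbit cyc_repr w),
      forall f : {mpoly rat[4]},
        poly_invariant cyc_repr f -> deg_le 3 f -> peval f v = peval f w
    & is_beta_sep_field rat C4 4].
Proof.
move=> v w; have card_C4 : #|C4| = 4%N by rewrite cardsT card_ord.
have neq_vw : ~ (vorbit cyc_repr v =i vorbit cyc_repr w).
  move=> /(_ w) eq_vw.
  have /imageP[g _ /matrixP/(_ 0 0)] : w \in vorbit cyc_repr v.
    rewrite eq_vw; apply/imageP; exists 1%g; first exact: group1.
    by rewrite repr_mx1 mul1mx.
  (* Entry 0 of [w] is 5, but entry 0 of a shift of [v] is one of 3, 4, -3, -4. *)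
  rewrite [RHS](cyc_mxE g v 0 0) !mxE.
  by case: (0 - g) => -[|[|[|[|i]]]] lt_i4 /eqP.
split=> //; first exact: C4_invariant_agree.
have sep4 n (rG : mx_representation rat C4 n) : separating_degree rG 4.
  by have := @separating_degree_card _ C4 n _ rG; rewrite card_C4.
split; last by move=> n rG; exact: is_beta_sep_exists.
(* The maximum is attained at [cyc_repr]: a separating degree [e < 4] would give an invariant of
   degree at most 3 separating [v] from [w]. *)
exists 4%N, cyc_repr; split=> // e _ /(_ v w neq_vw)[f [inv_f deg_f neq_f]].
rewrite leqNgt; apply/negP => lt_e4.
by apply/neq_f/C4_invariant_agree => //; exact: leq_trans deg_f lt_e4.
Qed.
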